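(* For every real number $c<e$ (where $e$ is the base of the natural logarithm) there exists a dimension $d$ such that no deterministic fractional online algorithm for the splittable $d$-dimensional Vector Bin Packing problem is $c$-competitive. In other words, no deterministic fractional online algorithm achieves a competitive ratio strictly better than $e$ for $d$-dimensional Vector Bin Packing when $d$ is arbitrarily large.
   Context: Online $d$-dimensional Vector Bin Packing: vectors $v_1,v_2,\ldots$ with $v_i=(v_i(1),\ldots,v_i(d))\in[0,1]^d$ arrive one at a time. Each bin has capacity $1$ in every coordinate, so a set $B$ of (pieces of) vectors placed in a bin must satisfy $\sum_{v\in B} v(k)\le 1$ for every coordinate $k\in\{1,\ldots,d\}$. On arrival, each vector must be irrevocably assigned to already opened bins or to newly opened bins, respecting the capacities. The objective is to minimize the number of bins used. In the splittable model, an arriving vector $v$ may be split into arbitrarily many pieces $\alpha_1 v,\ldots,\alpha_m v$ with $\alpha_l\ge 0$ and $\sum_l\alpha_l=1$, each piece placed in a different bin; the offline optimum is then $OPT=\max_k\lceil\sum_i v_i(k)\rceil$. A deterministic fractional algorithm in this model may additionally open fractional amounts of bins: opening an amount $\beta>0$ of a bin provides capacity $\beta$ in every coordinate and costs $\beta$; the algorithm's cost is the total amount of bins opened. An algorithm $ALG$ is $c$-competitive if there is a constant $a$ such that $ALG(\sigma)\le c\cdot OPT(\sigma)+a$ for every input sequence $\sigma$. *)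

(* Defs.v *)
From mathcomp Require Import all_boot all_order all_algebra.
From mathcomp Require Import all_reals all_analysis.

Set Implicit Arguments.
Unset Strict Implicit.
Unset Printing Implicit Defensive.

Import Order.TTheory GRing.Theory Num.Theory.
Local Open Scope ring_scope.

Definition valid_vector (R : realType) (d : nat) (v : 'rV[R]_d) : bool :=
  [forall k, 0 <= v 0 k <= 1].

Definition valid_input (R : realType) (d : nat) (sigma : seq 'rV[R]_d) : bool :=
  all (@valid_vector R d) sigma.

(* The response to one arriving vector [v]: first the bins of amounts [opened]
   are opened, then the piece [alpha_b v] goes into bin [b], where
   [alpha_b = nth 0 pieces b].  Bins are numbered in the order in which they
   are opened, so [pieces] ranges over old and new bins alike; a bin that
   receives nothing gets a piece with [alpha_b = 0]. *)
Record action (R : realType) := Action { opened : seq R; pieces : seq R }.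

(* [A p] is the response to the last vector of [p], given that [p] is what has
   arrived so far. *)
Definition policy (R : realType) (d : nat) := seq 'rV[R]_d -> action R.

Section Execution.
Variables (R : realType) (d : nat) (A : policy R d).
Implicit Types (sigma : seq 'rV[R]_d) (b : nat) (k : 'I_d).

Definition response sigma (i : nat) : action R := A (take i.+1 sigma).

(* Amounts of all the bins open after [sigma].  Each opening creates a bin of
   its own, whose amount never changes afterwards. *)
Definition amounts sigma : seq R :=
  flatten [seq opened (response sigma i) | i <- iota 0 (size sigma)].

Definition load sigma b k : R :=
  \sum_(i < size sigma) nth 0 (pieces (response sigma i)) b * (nth 0 sigma i) 0 k.

Definition cost sigma : R := \sum_(beta <- amounts sigma) beta.

(* Amounts larger than 1 are not excluded: a bin of amount [beta] can be
   replaced by several bins whose amounts sum to [beta], every piece being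
   divided among them in proportion, so a bound on the amounts would not
   change the achievable costs. *)
Definition online_algorithm : Prop :=
  forall sigma (v : 'rV[R]_d), valid_input (rcons sigma v) ->
  let tau := rcons sigma v in
  [/\ all (fun beta => 0 < beta) (amounts tau),
      [/\ size (pieces (A tau)) = size (amounts tau),
          all (fun alpha => 0 <= alpha) (pieces (A tau)) &
          \sum_(alpha <- pieces (A tau)) alpha = 1] &
      forall b k, (b < size (amounts tau))%N ->
        load tau b k <= nth 0 (amounts tau) b].

End Execution.

(* The ceilings are nonnegative on valid inputs, so [absz] is a mere cast. *)
Definition OPT (R : realType) (d : nat) (sigma : seq 'rV[R]_d) : nat :=
  \max_(k < d) `|Num.ceil (\sum_(v <- sigma) v 0 k)|%N.

Definition competitive (R : realType) (d : nat) (c : R) (A : policy R d) : Prop :=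
  exists a : R, forall sigma : seq 'rV[R]_d, valid_input sigma ->
    cost A sigma <= c * (OPT sigma)%:R + a.

(* Offline splittable packing into [m] unit bins. *)
Definition packable (R : realType) (d : nat) (sigma : seq 'rV[R]_d) (m : nat) : Prop :=
  exists x : 'I_(size sigma) -> 'I_m -> R,
    [/\ forall i b, 0 <= x i b,
        forall i, \sum_b x i b = 1 &
        forall b (k : 'I_d), \sum_i x i b * (nth 0 sigma i) 0 k <= 1].

(* [OPT] is the least number of unit bins; [0 < m] is only needed because the
   formula gives 0 when all the vectors are zero. *)
Lemma packable_OPT (R : realType) (d : nat) (sigma : seq 'rV[R]_d) (m : nat) :
  valid_input sigma -> (0 < m)%N -> packable sigma m <-> (OPT sigma <= m)%N.
Proof.
move=> vs m0.
have sum_ge0 k : 0 <= \sum_(v <- sigma) v 0 k.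
  by rewrite big_seq sumr_ge0// => v /(allP vs)/forallP/(_ k)/andP[].
have OPTE : (OPT sigma <= m)%N <-> forall k, \sum_(v <- sigma) v 0 k <= m%:R.
  have E k : (`|Num.ceil (\sum_(v <- sigma) v 0 k)|%N <= m)%N =
             (\sum_(v <- sigma) v 0 k <= m%:R).
    rewrite -(ceil_le_int _ m%:Z) -lez_nat gez0_abs// ceil_ge0.
    by rewrite (lt_le_trans _ (sum_ge0 k))// ltrN10.
  split=> [/bigmax_leqP h k|h]; first by rewrite -E h.
  by apply/bigmax_leqP => k _; rewrite E.
have sumE k : \sum_(v <- sigma) v 0 k =
    \sum_(i < size sigma) (nth 0 sigma i) 0 k.
  by rewrite (big_nth 0) big_mkord.
rewrite OPTE; split=> [[x [x0 x1 xl]] k|h].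
  rewrite sumE; under eq_bigr => i _ do rewrite -[_ 0 k]mul1r -(x1 i) mulr_suml.
  rewrite exchange_big/= -[leRHS]mulr1 mulr_natl.
  by apply: (le_trans (ler_sum _ (fun b _ => xl b k))); rewrite sumr_const card_ord.
have m0' : (m%:R : R) != 0 by rewrite pnatr_eq0 -lt0n.
exists (fun _ _ => m%:R^-1); split=> [i b|i|b k].
- by rewrite invr_ge0.
- by rewrite sumr_const card_ord -[_ *+ m]mulr_natr mulVf.
- by rewrite -mulr_sumr -sumE mulrC ler_pdivrMr ?ltr0n// mul1r.
Qed.

(* Main.v *)
(* Time runs through d phases of m identical vectors.  Coordinate k wakes up at
   phase k and then grows at a constant rate proportional to q^k, so its load
   after phase j is proportional to (j - k + 1) q^k <= q^j / a; with q = e^s one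
   can take a = e s / q, and OPT grows like q^j.  A bin opened during phase k
   absorbs input only while coordinate k is growing, so a bin of amount beta
   absorbs at most beta q^(d - k) vectors.  Summing over the bins by parts
   bounds the number d m of vectors by the costs at the ends of the phases; if
   these are at most c OPT + O(1), then d m <= (d rho + O(1)) m + O(1) with
   rho = c (q - 1) / (e s).  As s tends to 0 this tends to c / e < 1, which is
   impossible for large d and m. *)

Require Import Defs.
From mathcomp Require Import all_boot all_order all_algebra.
From mathcomp Require Import all_reals all_analysis.
From mathcomp Require Import ring lra.
Import Order.TTheory GRing.Theory Num.Theory.
Local Open Scope ring_scope.

Lemma amounts_take {R : realType} {d : nat} (A : policy R d) sigma n :
  (n <= size sigma)%N ->
  amounts A (take n sigma) =
  flatten [seq opened (response A sigma i) | i <- iota 0 n].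
Proof.
move=> le_n; rewrite /amounts size_takel//; congr flatten.
apply/eq_in_map => i; rewrite mem_iota add0n => /andP[_ i_n].
by rewrite /response take_takel.
Qed.

Lemma amounts_take_prefix {R : realType} {d : nat} (A : policy R d) sigma n p :
  (n <= p <= size sigma)%N ->
  amounts A (take n sigma) =
  take (size (amounts A (take n sigma))) (amounts A (take p sigma)).
Proof.
move=> /andP[np ps]; rewrite !amounts_take// ?(leq_trans np)//.
by rewrite -(subnKC np) iotaD map_cat flatten_cat take_size_cat.
Qed.

Lemma size_amounts_take {R : realType} {d : nat} (A : policy R d) sigma n p :
  (n <= p <= size sigma)%N ->
  (size (amounts A (take n sigma)) <= size (amounts A (take p sigma)))%N.
Proof.
by move=> h; rewrite (amounts_take_prefix A _ _ _ h) size_take_min geq_minr.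
Qed.

(** Indexes costs at all times by the bins of the full run, so that they can be combined by
    exchanging sums. *)
Lemma cost_take {R : realType} {d : nat} (A : policy R d) sigma n :
  (n <= size sigma)%N ->
  cost A (take n sigma) =
  \sum_(b < size (amounts A sigma) | (b < size (amounts A (take n sigma)))%N)
    nth 0 (amounts A sigma) b.
Proof.
move=> le_n; have h : (n <= size sigma <= size sigma)%N by rewrite le_n leqnn.
have := amounts_take_prefix A _ _ _ h; have := size_amounts_take A _ _ _ h.
rewrite take_size /cost; set a := amounts A sigma; set t := amounts A (take _ _).
move=> le_t tE; rewrite (big_nth 0) big_mkord.
rewrite (big_ord_widen _ (fun b => nth 0 t b) le_t); apply: eq_bigr => b b_t.
by rewrite tE nth_take.
Qed.

(* Weak duality: [y b] is the price of bin [b], charged on coordinate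
   [kappa b]. *)
Lemma size_le_priced_amounts {R : realType} {d : nat} (A : policy R d) sigma
    (y : nat -> R) (kappa : nat -> 'I_d) :
  online_algorithm A -> valid_input sigma ->
  (forall b, (b < size (amounts A sigma))%N -> 0 <= y b) ->
  (forall i b, (i < size sigma)%N ->
     (b < size (amounts A (take i.+1 sigma)))%N ->
     1 <= y b * (nth 0 sigma i) 0 (kappa b)) ->
  (size sigma)%:R <=
    \sum_(b < size (amounts A sigma)) y b * nth 0 (amounts A sigma) b.
Proof.
move=> onA vs y_ge0 y_cover.
have step i : (i < size sigma)%N ->
    [/\ size (pieces (response A sigma i)) = size (amounts A (take i.+1 sigma)),
        all (fun alpha => 0 <= alpha) (pieces (response A sigma i)) &
        \sum_(alpha <- pieces (response A sigma i)) alpha = 1].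
  move=> i_s; rewrite /response (take_nth 0 i_s).
  have vt : valid_input (rcons (take i sigma) (nth 0 sigma i)).
    rewrite -take_nth//; apply/allP => v /mem_take; exact/allP.
  by case: (onA _ _ vt).
have load_le b k : (b < size (amounts A sigma))%N ->
    load A sigma b k <= nth 0 (amounts A sigma) b.
  (* [online_algorithm] constrains nonempty inputs only; the empty input has no bins. *)
  case: (lastP sigma) vs => [_|t v vt]; first by rewrite /amounts.
  by case: (onA _ _ vt) => _ _ /(_ b k).
(* The pieces of a vector sum to 1 and lie in bins already open, where the price covers it; for
   later bins [nth] defaults to 0. *)
have unit_piece (i : 'I_(size sigma)) :
    1 <= \sum_(b < size (amounts A sigma))
      nth 0 (pieces (response A sigma i)) b *
        (y b * (nth 0 sigma i) 0 (kappa b)).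
  have [sz pos <-] := step i (ltn_ord i).
  have h : (i < size sigma <= size sigma)%N by rewrite ltn_ord leqnn.
  have := size_amounts_take A _ _ _ h; rewrite take_size -sz => le_sz.
  rewrite (big_nth 0) big_mkord.
  rewrite (big_ord_widen _ (fun b => nth 0 (pieces (response A sigma i)) b) le_sz).
  rewrite big_mkcond/=; apply: ler_sum => b _; case: ifPn => [b_lt|].
    rewrite ler_peMr//; first exact/(allP pos)/mem_nth.
    by apply: y_cover => //; rewrite -sz.
  by rewrite -leqNgt => b_ge; rewrite nth_default// mul0r.
apply: (@le_trans _ _ (\sum_(i < size sigma) \sum_(b < size (amounts A sigma))
      nth 0 (pieces (response A sigma i)) b *
        (y b * (nth 0 sigma i) 0 (kappa b)))).
  rewrite -[leLHS](_ : \sum_(i < size sigma) 1 = _); first exact: ler_sum.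
  by rewrite sumr_const card_ord.
rewrite exchange_big/=; apply: ler_sum => b _.
under eq_bigr do rewrite mulrCA.
by rewrite -mulr_sumr ler_wpM2l ?y_ge0// load_le.
Qed.

(* Coordinate [k] is dormant until time [k * m]; from then on it receives the
   same amount [q ^- (d - k)] from every vector. *)
Definition staircase (R : realType) (d m : nat) (q : R) : seq 'rV[R]_d :=
  mkseq (fun i => \row_k (if (k * m <= i)%N then q ^- (d - k) else 0)) (d * m).

Section Staircase.
Context {R : realType} (d m : nat) (q : R).
Hypothesis q_gt1 : 1 < q.

Let q_gt0 : 0 < q. Proof. exact: lt_trans q_gt1. Qed.

Lemma size_staircase : size (staircase R d m q) = (d * m)%N.
Proof. exact: size_mkseq. Qed.

Lemma nth_staircase i (k : 'I_d) : (i < d * m)%N ->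
  (nth 0 (staircase R d m q) i) 0 k =
  if (k * m <= i)%N then q ^- (d - k) else 0.
Proof. by move=> i_s; rewrite nth_mkseq// mxE. Qed.

Lemma valid_staircase : valid_input (staircase R d m q).
Proof.
apply/(all_nthP 0) => i; rewrite size_staircase => i_s.
apply/forallP => k; rewrite nth_staircase//; case: ifP => _; last first.
  by rewrite lexx ler01.
rewrite invr_ge0 exprn_ge0 ?(ltW q_gt0)//= invf_le1 ?exprn_gt0//.
by rewrite exprn_ege1// ltW.
Qed.

Lemma sum_staircase n (k : 'I_d) : (n <= d * m)%N ->
  \sum_(v <- take n (staircase R d m q)) v 0 k =
  (n - k * m)%:R * q ^- (d - k).
Proof.
move=> le_n; rewrite (big_nth 0) size_takel ?size_staircase//.
under eq_big_nat => i /andP[_ i_n].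
  rewrite nth_take// nth_staircase ?(leq_trans i_n)//; over.
elim: n le_n => [|n IH] le_n; first by rewrite big_geq// sub0n mul0r.
rewrite big_nat_recr//= IH ?(ltnW le_n)//; case: leqP => h.
  by rewrite subSn// -natr1 mulrDl mul1r.
by move: (ltnW h); rewrite /leq => /eqP->; rewrite (eqP h) !mul0r addr0.
Qed.

(** With t = j - k, the load of an awake coordinate is m q^-(d-j) times (t+1)/q^t, and the last
    factor is at most 1/a. The 1 pays for the ceiling. *)
Lemma OPT_staircase (a : R) j : 0 < a -> (j < d)%N ->
  (forall i, a * i.+1%:R <= q ^+ i) ->
  (OPT (take (j.+1 * m) (staircase R d m q)))%:R <=
    m%:R * q ^- (d - j) / a + 1.
Proof.
move=> a_gt0 j_d a_le; set X := m%:R * _ / a.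
have X_ge0 : 0 <= X.
  by rewrite divr_ge0 ?(ltW a_gt0)// mulr_ge0// invr_ge0 exprn_ge0// ltW.
rewrite /OPT; elim/big_ind: _ => [|x y hx hy|k _]; first exact: addr_ge0.
  by rewrite /maxn; case: ifP.
rewrite sum_staircase ?leq_mul2r ?j_d ?orbT// -mulnBl.
set S := (_ * _ : R).
have S_ge0 : 0 <= S by rewrite mulr_ge0// invr_ge0 exprn_ge0// ltW.
rewrite natr_absz ger0_norm; last by rewrite ceil_ge0 (lt_le_trans _ S_ge0).
rewrite (@le_trans _ _ (S + 1))//.
  by rewrite -lerBlDr -[1]/(1%:~R) -intrB ltW// ceilB1_lt.
rewrite lerD2r /S /X.
have [k_j|j_k] := leqP k j; last by rewrite (eqP j_k) mul0n mul0r.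
have -> : (d - k = (d - j) + (j - k))%N by rewrite addnBA// subnK// ltnW.
rewrite subSn// natrM exprD invfM ler_pdivlMr//.
set t := (j - k)%N; set u := q ^- (d - j).
have -> : t.+1%:R * m%:R * (u * q ^- t) * a = m%:R * u * (a * t.+1%:R / q ^+ t).
  by ring.
rewrite ler_piMr//; first by rewrite mulr_ge0// invr_ge0 exprn_ge0// ltW.
by rewrite ler_pdivrMr ?mul1r ?a_le// exprn_gt0.
Qed.

(** Prepares the summation by parts: the price of a bin opened in phase k is spread over the phase
    ends at which it is open. *)
Lemma expr_telescope k : (k <= d)%N ->
  q ^+ (d - k) =
  1 + \sum_(j < d | (k <= j)%N) (q ^+ (d - j) - q ^+ (d - j.+1)).
Proof.
move=> k_d; pose f j := - q ^+ (d - j).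
rewrite -(big_mkord (leq k) (fun j => q ^+ (d - j) - q ^+ (d - j.+1))).
rewrite -(@big_nat_widenl _ _ _ k 0 d predT)//.
rewrite (telescope_sumr_eq f)// => [|j _]; rewrite /f; last by ring.
by rewrite subnn expr0; ring.
Qed.

Lemma staircase_duality (A : policy R d) : online_algorithm A -> (0 < d)%N ->
  (d * m)%:R <= cost A (staircase R d m q) +
    \sum_(j < d) (q ^+ (d - j) - q ^+ (d - j.+1)) *
       cost A (take (j.+1 * m) (staircase R d m q)).
Proof.
move=> onA d_gt0; set s := staircase R d m q.
pose sz j := size (amounts A (take (j.+1 * m) s)).
have last_d : (d.-1 < d)%N by rewrite prednK.
(* The phase in which [b] is opened; the last phase is a legitimate default, since it ends with the
   input. *)
pose kappa (b : nat) : 'I_d := [arg min_(k < Ordinal last_d | b < sz k) k]%N.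
have kappaP b : (b < size (amounts A s))%N ->
    forall j : 'I_d, (kappa b <= j)%N = (b < sz j)%N.
  move=> b_s j; rewrite /kappa; case: arg_minnP => [|k b_k k_min].
    by rewrite /sz /= prednK// -size_staircase take_size.
  apply/idP/idP => [k_j|]; last exact: k_min.
  apply: (leq_trans b_k); apply: size_amounts_take.
  by rewrite size_staircase !leq_mul2r ltnS k_j ltn_ord !orbT.
have := size_le_priced_amounts A s (fun b => q ^+ (d - kappa b)) kappa onA
  valid_staircase.
rewrite size_staircase => /(_ _ _)/le_trans; apply.
- by move=> b _; rewrite exprn_ge0// ltW.
- move=> i b i_s b_i; rewrite nth_staircase//.
  have b_s : (b < size (amounts A s))%N.
    rewrite (leq_trans b_i)// -[leqRHS]/(size (amounts A s)) -{2}(take_size s).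
    by rewrite size_amounts_take// size_staircase i_s leqnn.
  (* The price is the reciprocal of the growth rate, so coordinate [kappa b] need only be awake.
     Otherwise [b] would be open by the end of the previous phase, against minimality. *)
  suff -> : (kappa b * m <= i)%N by rewrite divff// expf_neq0// gt_eqF.
  rewrite leqNgt; apply/negP => i_k.
  have k_gt0 : (0 < kappa b)%N by case: (kappa b : nat) i_k.
  have k_d : ((kappa b).-1 < d)%N by rewrite (leq_ltn_trans (leq_pred _)).
  suff : (kappa b <= Ordinal k_d)%N by rewrite leqNgt /= prednK// leqnn.
  rewrite kappaP// (leq_trans b_i)// size_amounts_take//= prednK// i_k.
  by rewrite size_staircase leq_mul2r ltnW ?orbT.
- under eq_bigr => b _ do
    rewrite (expr_telescope _ (ltnW (ltn_ord (kappa b)))) mulrDl mul1r mulr_suml.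
  rewrite big_split/= lerD//; first by rewrite /cost (big_nth 0) big_mkord.
  rewrite (exchange_big_dep predT)//=; apply: ler_sum => j _.
  rewrite cost_take; last by rewrite size_staircase leq_mul2r ltn_ord orbT.
  by rewrite -mulr_sumr; under eq_bigl => b do rewrite kappaP//.
Qed.

End Staircase.

Theorem theorem1 (R : realType) (c : R) (hc : c < expR 1) :
  exists2 d : nat, (0 < d)%N &
    forall A : policy R d, online_algorithm A -> ~ competitive c A.
Proof.
pose e : R := expR 1; pose c1 := Num.max c 1.
have e_gt1 : 1 < e by rewrite expR_gt1.
have c1_ge1 : 1 <= c1 by rewrite le_max lexx orbT.
have c_le : c <= c1 by rewrite le_max lexx.
have c1_lt : c1 < e by rewrite gt_max hc e_gt1.
have e_gt0 : 0 < e by lra.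
(* Makes e (1 - s) the midpoint of [c1] and e, hence above [c1]. *)
pose s := (e - c1) / (2 * e).
have s_gt0 : 0 < s by rewrite divr_gt0; lra.
have s_e : s * (2 * e) = e - c1 by rewrite /s; field; lra.
have s_lt1 : s < 1 by nra.
pose q := expR s; have q_gt1 : 1 < q by rewrite expR_gt1.
have q_gt0 : 0 < q by rewrite expR_gt0.
pose a := e * s / q; have a_gt0 : 0 < a.
  exact: divr_gt0 (mulr_gt0 e_gt0 s_gt0) q_gt0.
(* Take x = s (i + 1) - 1 in 1 + x <= exp x. *)
have a_le i : a * i.+1%:R <= q ^+ i.
  have := expR_ge1Dx (s * i.+1%:R - 1).
  rewrite addrC subrK expRD expRN ler_pdivlMr ?expR_gt0// => h.
  rewrite /a mulrAC ler_pdivrMr// -exprSr.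
  by rewrite -expRM_natr -mulrA mulrC.
pose rho := c1 * (1 - q^-1) / a.
have rho_lt1 : rho < 1.
  have iq_ge : 1 - s <= q^-1 by rewrite -expRN expR_ge1Dx.
  rewrite ltr_pdivrMr// mul1r /a; move: q^-1 iq_ge => iq iq_ge.
  apply: (@le_lt_trans _ _ (c1 * s)); first by rewrite ler_pM2l; lra.
  apply: (@lt_le_trans _ _ (e * s * (1 - s))).
    by rewrite mulrAC ltr_pM2r//; lra.
  by rewrite ler_pM2l// mulr_gt0.
(* The first term is the final cost per [m]; the 1 is reserved for the additive errors, which total
   K q^d < m. *)
have [d d_gt0 d_gt] :
    exists2 d : nat, (0 < d)%N & c1 / (a * q) + 1 < d%:R * (1 - rho).
  exists (Num.truncn ((c1 / (a * q) + 1) / (1 - rho))).+1 => //.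
  by rewrite -ltr_pdivrMr ?subr_gt0// truncnS_gt.
exists d => // A onA [a0 compA].
(* [c1] comes from rounding in [OPT], [a0] from competitiveness. *)
pose K := `|c1 + a0| : R.
have [m m_gt0 m_gt] : exists2 m : nat, 0 < m%:R :> R & K * q ^+ d < m%:R.
  by exists (Num.truncn (K * q ^+ d)).+1; rewrite ?ltr0n// truncnS_gt.
have cost_le j : (j < d)%N ->
    cost A (take (j.+1 * m) (staircase R d m q)) <=
      c1 / a * m%:R * q ^- (d - j) + K.
  move=> j_d.
  have vt : valid_input (take (j.+1 * m) (staircase R d m q)).
    by apply/allP => v /mem_take; exact/(allP (valid_staircase _ _ _ q_gt1)).
  have := OPT_staircase d m q q_gt1 a j a_gt0 j_d a_le.
  have := compA _ vt; set n := (OPT _)%:R; set u := q ^- _.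
  have n_ge0 : 0 <= n by [].
  have K_ge : c1 + a0 <= K by exact: ler_norm.
  have -> : c1 / a * m%:R * u = c1 * (m%:R * u / a) by ring.
  move: (m%:R * u / a) => X h n_X.
  have cn : c * n <= c1 * n by rewrite ler_wpM2r.
  have c1n : c1 * n <= c1 * (X + 1) by rewrite ler_wpM2l//; lra.
  by lra.
set st := staircase R d m q in cost_le.
have cost_last : cost A st <= c1 / a * m%:R * q^-1 + K.
  have := cost_le d.-1; rewrite prednK// -(size_staircase d m q) take_size.
  by rewrite -subn1 subKn// expr1; exact.
have dq_ge0 j : (j < d)%N -> 0 <= q ^+ (d - j) - q ^+ (d - j.+1).
  by move=> j_d; rewrite subr_ge0 ler_eXn2l// leq_sub2l.
have := staircase_duality d m q q_gt1 A onA d_gt0; apply/negP; rewrite -ltNge.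
pose w (j : nat) := q ^+ (d - j) - q ^+ (d - j.+1).
have sum_w : \sum_(j < d) w j = q ^+ d - 1.
  have := expr_telescope d q 0 (leq0n _); rewrite subn0 => ->.
  by rewrite addrC addKr.
apply: (@le_lt_trans _ _ (c1 / a * m%:R * q^-1 + K +
    \sum_(j < d) (c1 / a * m%:R * (1 - q^-1) + w j * K))).
  apply: lerD => //; apply: ler_sum => j _.
  rewrite (le_trans (ler_wpM2l (dq_ge0 j (ltn_ord j)) (cost_le j (ltn_ord j))))//.
  rewrite mulrDr lerD2r /w -(subnSK (ltn_ord j)) exprS.
  have : q ^+ (d - j.+1) != 0 by rewrite expf_neq0// gt_eqF.
  move: (q ^+ _) => p p_neq0.
  rewrite le_eqVlt; apply/orP; left; apply/eqP; field.
  by rewrite p_neq0 !gt_eqF.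
rewrite big_split sumr_const card_ord -mulr_suml sum_w -[_ *+ d]mulr_natl natrM.
have rhoE : c1 / a * m%:R * (1 - q^-1) = m%:R * rho by rewrite /rho; ring.
rewrite rhoE; have := d_gt; rewrite -(ltr_pM2l m_gt0).
have -> : c1 / a * m%:R / q = m%:R * (c1 / (a * q)) by field; rewrite !gt_eqF.
move: (c1 / (a * q)) => X h /=; lra.
Qed.
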